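(* Let $(T_n)_{n\ge1}$ be a sequential dynamical system on $[0,1]$ such that all maps $T_n$ belong to a class $\mathcal{C}$ of piecewise expanding maps that satisfies $(D_r)$ (for some $r\ge1$) and (Dec), and for which the condition (Min) holds. Then for any $f\in\mathrm{BV}$ and all $t>0$ there exist $\tau=\tau(f)>0$ (depending on $f$ but not on $t$) and $C=C(f,t)>0$ such that for all $n\ge1$, $$m\left(\frac1n\sum_{k=0}^{n-1}\left[f\circ T_1^k-\int f\circ T_1^k\,dm\right]>t\right)\le Ce^{-\tau nt^2}.$$
   Context: $m$ is Lebesgue measure on $[0,1]$ with its Borel $\sigma$-algebra. A piecewise expanding map is a map $T:[0,1]\to[0,1]$ with $\inf_x|T'(x)|>1$ for which there is a finite partition $\mathcal{A}_T$ of $[0,1]$ into intervals with disjoint interiors such that $T$ can be extended to a $C^2$ map on a neighborhood of each element of $\mathcal{A}_T$. Its transfer operator $P_T:L^1(m)\to L^1(m)$ is characterized by $\int P_Tf\cdot g\,dm=\int f\cdot g\circ T\,dm$ for $f\in L^1(m)$, $g\in L^\infty(m)$. For $f\in L^1(m)$, $\mathrm{V}f$ is the infimum of the total variations on $[0,1]$ of the functions $\bar f$ with $\bar f=f$ $m$-a.e.; $\mathrm{BV}=\{f\in L^1(m):\mathrm{V}f<\infty\}$ with norm $\|f\|_{\mathrm{BV}}=\mathrm{V}f+\|f\|_{L^1_m}$. $(D_r)$: a class $\mathcal{C}$ of piecewise expanding maps satisfies $(D_r)$, $r\ge1$ an integer, if there are constants $0<\rho_r<1$, $M_0>0$, $C_r>0$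 such that $\|P_Tf\|_{\mathrm{BV}}\le M_0\|f\|_{\mathrm{BV}}$ for all $T\in\mathcal{C}$, $f\in\mathrm{BV}$, and $\|P_{T_r}\cdots P_{T_1}f\|_{\mathrm{BV}}\le\rho_r\|f\|_{\mathrm{BV}}+C_r\|f\|_{L^1_m}$ for all $T_1,\ldots,T_r\in\mathcal{C}$, $f\in\mathrm{BV}$. (Dec): $\mathcal{C}$ satisfies (Dec) if there exist $0<\theta<1$ and $K_0>0$ such that for all $l\ge1$, all $T_1,\ldots,T_l\in\mathcal{C}$ and all $f\in\mathrm{BV}$ with $\int f\,dm=0$, $\|P_{T_l}\cdots P_{T_1}f\|_{\mathrm{BV}}\le K_0\theta^l\|f\|_{\mathrm{BV}}$. For a sequence $(T_n)_{n\ge1}$ and $n\le k$: $T_n^k=T_k\circ\cdots\circ T_n$, $P_n^k=P_{T_k}\cdots P_{T_n}$, and $T_1^0=\mathrm{Id}$. (Min): the sequence $(T_n)$ satisfies (Min) if there is $\delta>0$ with $P_1^n\mathbf{1}\ge\delta$ ($m$-a.e.) for all $n\ge1$. *)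

(* Defs.v *)
(* Libraries: MathComp and MathComp-Analysis. *)
From HB Require Import structures.
From mathcomp Require Import all_boot all_order all_algebra.
From mathcomp Require Import all_classical all_reals all_analysis.

Set Implicit Arguments.
Unset Strict Implicit.
Unset Printing Implicit Defensive.

Import Order.TTheory GRing.Theory Num.Theory.
Import numFieldNormedType.Exports.

Local Open Scope classical_set_scope.
Local Open Scope ring_scope.

(* Functions and maps on [0,1] are total functions R -> R; nothing below
   depends on their values outside [0,1]. Elements of L^1(m), m being Lebesgue
   measure on the Borel sets of [0,1], are given by representatives. *)
Definition unitI (R : realType) : set R := `[0, 1]%classic.

Local Notation leb := lebesgue_measure.

Definition ae_eq01 (R : realType) (f g : R -> R) : Prop :=
  {ae leb, forall x : R, unitI x -> f x = g x}.

Definition L1 (R : realType) (f : R -> R) : Prop :=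
  leb.-integrable (@unitI R) (EFin \o f).

Definition Linfty (R : realType) (g : R -> R) : Prop :=
  measurable_fun (@unitI R) g /\
  exists M : R, {ae leb, forall x : R, unitI x -> `|g x| <= M}.

Definition L1norm (R : realType) (f : R -> R) : \bar R :=
  (\int[leb]_(x in @unitI R) `|f x|%:E)%E.

Definition ess_variation (R : realType) (f : R -> R) : \bar R :=
  ereal_inf [set total_variation 0 1 g | g in [set g | ae_eq01 g f]].

Definition BV (R : realType) (f : R -> R) : Prop :=
  L1 f /\ (ess_variation f < +oo)%E.

Definition BVnorm (R : realType) (f : R -> R) : \bar R :=
  (ess_variation f + L1norm f)%E.

Definition C2_on (R : realType) (U : set R) (g : R -> R) : Prop :=
  forall x, U x -> [/\ derivable g x 1, derivable (derive1 g) x 1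
                     & {for x, continuous (derive1n 2 g)}].

(* The partition is given by its endpoints 0 = a_0 < a_1 < ... < a_p = 1
   (the list s is a_1, ..., a_p), its elements being the [a_i, a_(i+1)]. At
   an endpoint T may be discontinuous, so the C^2 extension is that of the
   restriction of T to the open interval, and it lives on a neighborhood of
   the closed one. The infimum of |T'| is over the points of ]0,1[ where T'
   exists, which include the interiors of all elements of the partition. *)
Definition piecewise_expanding (R : realType) (T : R -> R) : Prop :=
  [/\ forall x, unitI x -> unitI (T x),
      (1 < ereal_inf [set `|derive1 T x|%:E |
                        x in [set x : R | (0 < x < 1)%R /\ derivable T x 1]])%E
    & exists2 s : seq R, itv_partition 0 1 s &
        forall i, (i < size s)%N ->
          exists (U : set R) (g : R -> R),
            [/\ open U,
                `[nth 0 (0 :: s) i, nth 0 (0 :: s) i.+1]%classic `<=` U,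
                C2_on U g
              & {in `]nth 0 (0 :: s) i, nth 0 (0 :: s) i.+1[, T =1 g}]].

Definition is_transfer (R : realType) (T f h : R -> R) : Prop :=
  L1 h /\ forall g : R -> R, Linfty g ->
    (\int[leb]_(x in @unitI R) (h x * g x)%:E =
     \int[leb]_(x in @unitI R) (f x * g (T x))%:E)%E.

(* The defining property determines P_T f up to equality m-a.e., so a
   representative is chosen. For T piecewise expanding and f in L^1(m) one
   exists by the Radon-Nikodym theorem, T being nonsingular; otherwise the
   value is arbitrary. *)
Definition transfer (R : realType) (T f : R -> R) : R -> R :=
  get [set h | is_transfer T f h].

(* T_k \o ... \o T_n; the identity when k < n, in particular for T_1^0. *)
Definition seq_map (R : realType) (T : nat -> R -> R) (n k : nat) : R -> R :=
  foldl (fun S i => T i \o S) id (index_iota n k.+1).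

(* P_(T_k) ... P_(T_n) f *)
Definition seq_transfer (R : realType) (T : nat -> R -> R) (n k : nat)
    (f : R -> R) : R -> R :=
  foldl (fun h i => transfer (T i) h) f (index_iota n k.+1).

Definition cond_D (R : realType) (r : nat) (C : set (R -> R)) : Prop :=
  exists rho M0 Cr : R,
    [/\ 0 < rho < 1, 0 < M0, 0 < Cr,
        forall T f : R -> R, C T -> BV f ->
          (BVnorm (transfer T f) <= M0%:E * BVnorm f)%E
      & forall (T : nat -> R -> R) (f : R -> R),
          (forall i, (1 <= i <= r)%N -> C (T i)) -> BV f ->
          (BVnorm (seq_transfer T 1 r f)
             <= rho%:E * BVnorm f + Cr%:E * L1norm f)%E].

Definition cond_Dec (R : realType) (C : set (R -> R)) : Prop :=
  exists theta K0 : R,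
    [/\ 0 < theta < 1, 0 < K0
      & forall (l : nat) (T : nat -> R -> R) (f : R -> R),
          (1 <= l)%N -> (forall i, (1 <= i <= l)%N -> C (T i)) ->
          BV f -> (\int[leb]_(x in @unitI R) (f x)%:E = 0)%E ->
          (BVnorm (seq_transfer T 1 l f)
             <= (K0 * theta ^+ l)%:E * BVnorm f)%E].

Definition cond_Min (R : realType) (T : nat -> R -> R) : Prop :=
  exists2 delta : R, 0 < delta &
    forall n, (1 <= n)%N ->
      {ae leb, forall x : R, unitI x ->
         delta <= seq_transfer T 1 n (cst 1) x}.

(* Main.v *)
(** The proof goes through a reverse martingale approximation. Let
    [g_k = P_1^k 1], bounded in BV by (D_r) and bounded below by (Min), and
    [f_k = f - int (f o T_1^k)]. By (Dec) the functions
    [H_k = sum_(i < k) P_(i+1)^k (f_i g_i)] are bounded uniformly in [k], hence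
    so are [h_k = H_k / g_k]. As [H_(k+1) = P_(k+1) (f_k g_k + H_k)], the
    functions [U_k = f_k + h_k - h_(k+1) o T_(k+1)] satisfy
    [int g_k U_k (G o T_(k+1)) = 0] for all bounded [G], i.e. the [U_k o T_1^k]
    are reverse martingale differences, and their sum over [k < n] differs from
    that of the [f_k o T_1^k] by a bounded coboundary. An Azuma-type estimate
    of [int exp (lam sum_k U_k o T_1^k)] and Markov's inequality conclude. *)

(* [transfer] is picked from an existence statement, so nothing is known about it until existence is
   proved. For this reason piecewise expanding maps are first shown to be nonsingular, and
   identities between transfers are obtained by duality and hold only almost everywhere. The
   exponential products, by contrast, are composed along orbits and bounded pointwise; hence [f] and
   the quotients [h_k] are replaced by truncations that agree with them almost everywhere. (Min)
   does more than allow the division by [g_k]: it gives [g_k >= 0], so that [g_k] has L^1 norm 1 and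
   (D_r) becomes a closed recursion for the BV norms. Subtracting the mean at each time makes
   [f_k g_k] have integral 0, which is what (Dec) asks for. The coboundary costs a factor that
   depends on [t] but not on [n]; this is the dependence of [C(f,t)] on [t]. *)
Require Import Defs.
From HB Require Import structures.
From mathcomp Require Import all_boot all_order all_algebra.
From mathcomp Require Import all_classical all_reals all_analysis.
From mathcomp Require Import measurable_realfun.
From mathcomp Require Import ring lra.

Set Implicit Arguments.
Unset Strict Implicit.
Unset Printing Implicit Defensive.

Import Order.TTheory GRing.Theory Num.Theory.
Import numFieldNormedType.Exports.

Local Open Scope classical_set_scope.
Local Open Scope ring_scope.

(** * Integration over the unit interval *)

Section Integration.
Context {R : realType}.
Local Notation leb := (@lebesgue_measure R).
Local Notation I := (@unitI R).
Implicit Types (f g h G : R -> R).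

(** The bound is required at every point of [I], so that it survives composition with any map of [I]
    into itself. *)
Definition bounded_meas G : Prop :=
  measurable_fun I G /\ exists M : R, forall x, I x -> `|G x| <= M.

Lemma measurable_unitI : measurable I.
Proof. exact: measurable_itv. Qed.

Lemma measurableR_unitI : measurable (I : set (measurableTypeR R)).
Proof. exact: measurable_unitI. Qed.
Local Hint Resolve measurable_unitI measurableR_unitI : core.

Lemma lebesgue_unitI : leb I = 1%E.
Proof. by rewrite /unitI lebesgue_measure_itv/= lte01 oppr0 adde0. Qed.

Lemma L1_measurable f : L1 f -> measurable_fun I f.
Proof. by move=> /(measurable_int _)/measurable_EFinP. Qed.
Local Hint Resolve L1_measurable : core.

Lemma L1_le f g : measurable_fun I f -> L1 g ->
  (forall x, I x -> `|f x| <= `|g x|) -> L1 f.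
Proof.
by move=> mf Lg fg; apply: le_integrable Lg => //; exact/measurable_EFinP.
Qed.

Lemma L1_cst (c : R) : L1 (cst c).
Proof.
apply: measurable_bounded_integrable => //.
  by rewrite [ltLHS]lebesgue_unitI ltry.
by exists `|c|; split; [exact: num_real|move=> M cM x Ix; exact: ltW].
Qed.

Lemma Rintegral_unitI_cst (c : R) : \int[leb]_(x in I) cst c x = c.
Proof. by rewrite Rintegral_cst// [X in fine X]lebesgue_unitI mulr1. Qed.

Lemma bounded_meas_L1 G : bounded_meas G -> L1 G.
Proof.
move=> [mG [M GM]]; apply: (L1_le mG (L1_cst M)) => x Ix.
by rewrite (le_trans (GM x Ix))// ler_norm.
Qed.

Lemma bounded_meas_Linfty G : bounded_meas G -> Linfty G.
Proof. by move=> [mG [M GM]]; split => //; exists M; exact: aeW. Qed.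

Lemma bounded_meas_cst (c : R) : bounded_meas (cst c).
Proof. by split; [exact: measurable_cst|exists `|c|]. Qed.

Lemma bounded_measD f g :
  bounded_meas f -> bounded_meas g -> bounded_meas (fun x => f x + g x).
Proof.
move=> [mf [M fM]] [mg [N gN]]; split; first exact: measurable_funD.
exists (M + N) => x Ix.
by rewrite (le_trans (ler_normD _ _))// lerD ?fM ?gN.
Qed.

Lemma bounded_measN f : bounded_meas f -> bounded_meas (fun x => - f x).
Proof.
move=> [mf [M fM]]; split; first exact: measurable_funN.
by exists M => x Ix; rewrite normrN fM.
Qed.

Lemma bounded_measM f g :
  bounded_meas f -> bounded_meas g -> bounded_meas (fun x => f x * g x).
Proof.
move=> [mf [M fM]] [mg [N gN]]; split; first exact: measurable_funM.
by exists (M * N) => x Ix; rewrite normrM ler_pM ?fM ?gN.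
Qed.

Lemma bounded_meas_expR f :
  bounded_meas f -> bounded_meas (fun x => expR (f x)).
Proof.
move=> [mf [M fM]]; split; first exact: measurableT_comp.
exists (expR M) => x Ix; rewrite ger0_norm ?expR_ge0// ler_expR.
by rewrite (le_trans (ler_norm _))// fM.
Qed.

(** Truncation turns an almost everywhere bound into one valid everywhere. *)
Definition clip (M x : R) : R := Num.max (- M) (Num.min M x).

Lemma clip_le M x : 0 <= M -> `|clip M x| <= M.
Proof.
move=> M0; rewrite /clip ler_norml le_max lexx/= ge_max ge_min lexx/= andbT.
by rewrite (@le_trans _ _ 0)// oppr_le0.
Qed.

Lemma clip_id M x : `|x| <= M -> clip M x = x.
Proof. by rewrite ler_norml /clip => /andP[Mx xM]; rewrite min_r// max_r. Qed.

Lemma bounded_meas_clip M f : 0 <= M ->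
  measurable_fun I f -> bounded_meas (fun x => clip M (f x)).
Proof.
move=> M0 mf; split; last by exists M => x _; exact: clip_le.
by apply: measurable_maxr => //; exact: measurable_minr.
Qed.

Lemma L1D f g : L1 f -> L1 g -> L1 (fun x => f x + g x).
Proof. by move=> Lf Lg; exact: (integrableD _ Lf Lg). Qed.

Lemma L1N f : L1 f -> L1 (fun x => - f x).
Proof. by move=> Lf; exact: (integrableN Lf). Qed.

Lemma L1B f g : L1 f -> L1 g -> L1 (fun x => f x - g x).
Proof. by move=> Lf Lg; exact/(L1D Lf)/L1N. Qed.

Lemma L1M f G : L1 f -> bounded_meas G -> L1 (fun x => f x * G x).
Proof.
move=> Lf [mG [M GM]].
have LMf : L1 (fun x => M * f x).
  exact: (@integrableZl _ _ _ leb I _ M _ Lf).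
apply: (L1_le _ LMf) => [|x Ix].
  exact: measurable_funM (L1_measurable Lf) mG.
rewrite !normrM mulrC ler_wpM2r//.
by rewrite (le_trans (GM x Ix))// ler_norm.
Qed.

Lemma L1_sum n (F : nat -> R -> R) : (forall k, (k < n)%N -> L1 (F k)) ->
  L1 (fun x => \sum_(k < n) F k x).
Proof.
elim: n => [|n IH] LF.
  by under [X in L1 X]funext do rewrite big_ord0; exact: L1_cst.
under [X in L1 X]funext do rewrite big_ord_recr/=.
by apply: L1D; [apply: IH => k kn; apply: LF; rewrite ltnW|exact: LF].
Qed.

(* Stated because [filterS] finds no filter instance here: [leb] lives on
   [measurableTypeR R], not on [R]. *)
Lemma ae_impl (P Q : R -> Prop) : {ae leb, forall x, P x} ->
  (forall x, P x -> Q x) -> {ae leb, forall x, Q x}.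
Proof.
by move=> aeP PQ; exact: (@filterS _ _ (ae_filter_ringOfSetsType leb) P Q).
Qed.

Lemma ae_impl2 (P Q S : R -> Prop) : {ae leb, forall x, P x} ->
  {ae leb, forall x, Q x} -> (forall x, P x -> Q x -> S x) ->
  {ae leb, forall x, S x}.
Proof.
move=> aeP aeQ PQS.
exact: (@filterS2 _ _ (ae_filter_ringOfSetsType leb) P Q S).
Qed.

Lemma ae_Rintegral f g : measurable_fun I f -> measurable_fun I g ->
  ae_eq01 f g -> \int[leb]_(x in I) f x = \int[leb]_(x in I) g x.
Proof.
move=> mf mg fg; congr fine.
apply: ae_eq_integral => //; try exact/measurable_EFinP.
by apply: (ae_impl fg) => x /= {}fg Ix; rewrite fg.
Qed.

Lemma ae_le_Rintegral f g : L1 f -> L1 g ->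
  {ae leb, forall x, I x -> f x <= g x} ->
  \int[leb]_(x in I) f x <= \int[leb]_(x in I) g x.
Proof.
(* The maximum equals [g] almost everywhere and dominates [f] everywhere, so pointwise monotonicity
   of the integral applies to it. *)
move=> Lf Lg fg; pose g' x := Num.max (f x) (g x).
have mg' : measurable_fun I g'.
  exact: measurable_maxr (L1_measurable Lf) (L1_measurable Lg).
have -> : \int[leb]_(x in I) g x = \int[leb]_(x in I) g' x.
  apply: ae_Rintegral => //; first exact: L1_measurable.
  by apply: (ae_impl fg) => x /= {}fg Ix; rewrite /g' max_r// fg.
apply: le_Rintegral => //; last by move=> x Ix; rewrite /g' le_max lexx.
have LL : L1 (fun x => `|f x| + `|g x|).
  by apply: L1D; [exact: (integrable_norm Lf)|exact: (integrable_norm Lg)].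
apply: (L1_le mg' LL) => x Ix; rewrite [leRHS]ger0_norm ?addr_ge0// /g'.
by rewrite maxEle; case: ifP => _; [rewrite lerDr|rewrite lerDl].
Qed.

Lemma ae_L1 f g : L1 f -> measurable_fun I g -> ae_eq01 g f -> L1 g.
Proof.
move=> /integrableP[mf foo] mg fg; apply/integrableP.
split; first exact/measurable_EFinP.
apply: le_lt_trans foo; rewrite le_eqVlt; apply/orP; left; apply/eqP.
apply: ae_eq_integral => //.
- by apply: measurableT_comp => //; exact/measurable_EFinP.
- exact: measurableT_comp.
- by apply: (ae_impl fg) => x /= {}fg Ix; rewrite fg.
Qed.

Lemma ae_bounded_L1 f M : measurable_fun I f ->
  {ae leb, forall x, I x -> `|f x| <= M} -> L1 f.
Proof.
move=> mf fM.
have bc := bounded_meas_clip (normr_ge0 M) mf.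
apply: (ae_L1 (bounded_meas_L1 bc) mf).
apply: (ae_impl fM) => x /= {}fM Ix; rewrite clip_id//.
by rewrite (le_trans (fM Ix))// ler_norm.
Qed.

Lemma ae_eq01_sym f g : ae_eq01 f g -> ae_eq01 g f.
Proof. by move/ae_impl; apply => x /= fg Ix; rewrite fg. Qed.

Lemma ae_eq01_trans f g h : ae_eq01 f g -> ae_eq01 g h -> ae_eq01 f h.
Proof.
by move=> fg /(ae_impl2 fg); apply => x /= {}fg gh Ix; rewrite fg ?gh.
Qed.

Lemma L1_EFin_Rintegral f : L1 f ->
  (\int[leb]_(x in I) f x)%:E = (\int[leb]_(x in I) (f x)%:E)%E.
Proof. by move=> Lf; rewrite fineK//; exact: integrable_fin_num. Qed.

(** Indicators of measurable subsets of [I] are already enough test functions. *)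
Lemma L1_ae_unique h1 h2 : L1 h1 -> L1 h2 ->
  (forall G, bounded_meas G -> \int[leb]_(x in I) (h1 x * G x) =
                               \int[leb]_(x in I) (h2 x * G x)) ->
  ae_eq01 h1 h2.
Proof.
move=> L1h L2h h12.
suff : ae_eq leb I (EFin \o h1) (EFin \o h2).
  by move/ae_impl; apply => x /= + Ix => /(_ Ix)[].
apply: integral_ae_eq => [//|//||].
  exact: (measurable_int _ L2h).
move=> E EI mE.
have bE : bounded_meas (\1_E : R -> R).
  split; first exact: measurable_indic.
  by exists 1 => x _; rewrite indicE; case: (_ \in _); rewrite ?normr1 ?normr0.
have eqE h : L1 h ->
    (\int[leb]_(x in E) (h x)%:E = (\int[leb]_(x in I) (h x * \1_E x))%:E)%E.
  move=> Lh; rewrite L1_EFin_Rintegral; last exact: L1M.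
  rewrite -{1}(setIidr EI) integral_mkcondr.
  apply: eq_integral => x _; rewrite patchE indicE.
  by case: ifP => _; rewrite ?mulr1 ?mulr0.
by rewrite /comp eqE// eqE// h12.
Qed.

End Integration.

(** * Transfer operators of nonsingular maps *)

Section Transfer.
Import HBNNSimple.
Context {R : realType}.
Local Notation leb := (@lebesgue_measure R).
Local Notation I := (@unitI R).
Local Hint Resolve measurable_unitI measurableR_unitI : core.
Implicit Types (T f g h G : R -> R).

(** The last clause makes composition with [T] compatible with almost everywhere equality, and the
    push-forward of [f dm] absolutely continuous. *)
Definition nonsingular T : Prop :=
  [/\ measurable_fun I T, forall x, I x -> I (T x)
    & forall N : set R, measurable N -> leb N = 0%E ->
        leb (I `&` T @^-1` N) = 0%E].

Lemma nonsingular_ae T (P : R -> Prop) : nonsingular T ->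
  {ae leb, forall x, I x -> P x} -> {ae leb, forall x, I x -> P (T x)}.
Proof.
move=> [mT TI T0] [N [mN N0 PN]]; exists (I `&` T @^-1` N); split.
- exact: (mT measurable_unitI N mN).
- by apply: T0.
- move=> x /= /not_implyP[Ix PTx]; split => //; apply: PN => /= /(_ (TI _ Ix)).
  by [].
Qed.

Lemma measurable_nonsingular_comp T g : nonsingular T ->
  measurable_fun I g -> measurable_fun I (fun x => g (T x)).
Proof.
move=> [mT TI _] mg; apply: (measurable_comp measurable_unitI _ mg mT).
by move=> _ [x Ix <-]; exact: TI.
Qed.

Lemma bounded_meas_comp T G : nonsingular T ->
  bounded_meas G -> bounded_meas (fun x => G (T x)).
Proof.
move=> nsT [mG [M GM]]; split; first exact: measurable_nonsingular_comp.
by exists M => x Ix; apply: GM; case: nsT => _ + _; exact.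
Qed.

Definition dual_eq T f h G :=
  \int[leb]_(x in I) (h x * G x) = \int[leb]_(x in I) (f x * G (T x)).

Section duality.
Variables (T f h : R -> R).
Hypotheses (nsT : nonsingular T) (Lf : L1 f) (Lh : L1 h).

Let L1h G : bounded_meas G -> L1 (fun x => h x * G x).
Proof. exact: L1M. Qed.

Let L1f G : bounded_meas G -> L1 (fun x => f x * G (T x)).
Proof. by move=> bG; apply: L1M => //; exact: bounded_meas_comp. Qed.

Lemma dual_eqD G1 G2 : bounded_meas G1 -> bounded_meas G2 ->
  dual_eq T f h G1 -> dual_eq T f h G2 ->
  dual_eq T f h (fun x => G1 x + G2 x).
Proof.
move=> b1 b2 e1 e2; rewrite /dual_eq.
under eq_Rintegral do rewrite mulrDr.
under [RHS]eq_Rintegral do rewrite mulrDr.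
rewrite RintegralD//; [|exact: L1h|exact: L1h].
by rewrite RintegralD//; [rewrite e1 e2|exact: L1f|exact: L1f].
Qed.

Lemma dual_eqZ (c : R) G : bounded_meas G ->
  dual_eq T f h G -> dual_eq T f h (fun x => c * G x).
Proof.
move=> bG eG; rewrite /dual_eq.
under eq_Rintegral do rewrite mulrCA.
under [RHS]eq_Rintegral do rewrite mulrCA.
rewrite RintegralZl//; last exact: L1h.
by rewrite RintegralZl//; [rewrite eG|exact: L1f].
Qed.

(** Dominated convergence on each side, with dominating functions [M |h|] and [M |f|]. *)
Lemma dual_eq_cvg (G_ : nat -> R -> R) G (M : R) :
  (forall n, measurable_fun I (G_ n)) -> bounded_meas G ->
  (forall n x, I x -> `|G_ n x| <= M) ->
  (forall x, I x -> G_ n x @[n --> \oo] --> G x) ->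
  (forall n, dual_eq T f h (G_ n)) -> dual_eq T f h G.
Proof.
move=> mG_ bG GM cG eG; have mG := bG.1.
have bG_ n : bounded_meas (G_ n) by split => //; exists M => x Ix; exact: GM.
have key (k : R -> R) (F : R -> R) (F_ : nat -> R -> R) : L1 k ->
    (forall n, measurable_fun I (F_ n)) -> measurable_fun I F ->
    (forall n x, I x -> `|F_ n x| <= M) ->
    (forall x, I x -> F_ n x @[n --> \oo] --> F x) ->
    (\int[leb]_(x in I) (k x * F_ n x)%:E @[n --> \oo] -->
     \int[leb]_(x in I) (k x * F x)%:E)%E.
  move=> Lk mF_ mF FM cF.
  apply: (@dominated_cvg _ _ _ leb I _ (fun n x => (k x * F_ n x)%:E)
            (fun x => (k x * F x)%:E) (fun x => (`|k x| * M)%:E)) => //.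
  - move=> n; apply/measurable_EFinP.
    exact: (measurable_funM (L1_measurable Lk) (mF_ n)).
  - move=> x Ix; apply: cvg_EFin; first exact: nearW.
    by apply: cvgMr; exact: cF.
  - have Lk' : L1 (fun x => `|k x|) by exact: (integrable_norm Lk).
    have bM : bounded_meas (cst M : R -> R) by exact: bounded_meas_cst.
    exact: L1M Lk' bM.
  - by move=> n x Ix; rewrite lee_fin normrM ler_wpM2l// FM.
have c1 := key h G G_ Lh mG_ mG GM cG.
have c2 : (\int[leb]_(x in I) (f x * G_ n (T x))%:E @[n --> \oo] -->
     \int[leb]_(x in I) (f x * G (T x))%:E)%E.
  have TI : forall x, I x -> I (T x) by case: nsT.
  apply: (key f (G \o T) (fun n => G_ n \o T)) => //.
  - by move=> n; exact: measurable_nonsingular_comp.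
  - exact: measurable_nonsingular_comp.
  - by move=> n x Ix; apply: GM; exact: TI.
  - by move=> x Ix; apply: cG; exact: TI.
rewrite /dual_eq /Rintegral; congr fine.
apply: cvg_unique c1 _; first exact: ereal_hausdorff.
suff -> : (fun n => \int[leb]_(x in I) (h x * G_ n x)%:E)%E =
   (fun n => \int[leb]_(x in I) (f x * G_ n (T x))%:E)%E by [].
apply/funext => n; rewrite -L1_EFin_Rintegral; last exact: L1h.
by rewrite -L1_EFin_Rintegral; [rewrite (eG n)|exact: L1f].
Qed.

Hypothesis dual_indic : forall A : set R, measurable A -> dual_eq T f h (\1_A).

(** From indicators to simple functions by linearity, to nonnegative bounded functions by simple
    approximation from below, and to all bounded ones by adding a constant. *)
Lemma dual_eq_bounded G : bounded_meas G -> dual_eq T f h G.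
Proof.
move=> bG.
have b1 (A : set R) : measurable A -> bounded_meas (\1_A : R -> R).
  move=> mA; split; first exact: measurable_indic.
  by exists 1 => x _; rewrite indicE; case: (_ \in _); rewrite ?normr1 ?normr0.
have simple (phi : {nnsfun R >-> R}) : dual_eq T f h phi.
  have -> : (phi : R -> R) =
      (fun x => \sum_(y <- finmap.enum_fset (fset_set (range phi)))
        y * \1_(phi @^-1` [set y]) x).
    apply/funext => x; rewrite {1}(fimfunE phi x) fsbig_finite//.
  have mphi y : measurable (phi @^-1` [set y]) by [].
  elim: (finmap.enum_fset _) => [|y s IH].
    rewrite /dual_eq; under eq_Rintegral do rewrite big_nil mulr0.
    by under [RHS]eq_Rintegral do rewrite big_nil mulr0.
  under [X in dual_eq _ _ _ X]funext do rewrite big_cons.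
  apply: dual_eqD => //.
  - by apply: bounded_measM; [exact: bounded_meas_cst|exact: b1].
  - elim: s {IH} => [|z s IH].
      under [X in bounded_meas X]funext do rewrite big_nil.
      exact: bounded_meas_cst.
    under [X in bounded_meas X]funext do rewrite big_cons.
    apply: bounded_measD => //.
    by apply: bounded_measM; [exact: bounded_meas_cst|exact: b1].
  - by apply: dual_eqZ; [exact: b1|exact: dual_indic].
have nneg F : bounded_meas F -> (forall x, I x -> 0 <= F x) -> dual_eq T f h F.
  move=> [mF [M FM]] F0.
  have mI : measurable (I : set R) by [].
  have mEF : measurable_fun I (EFin \o F) by exact/measurable_EFinP.
  have F0' x : I x -> (0%R <= (EFin \o F) x)%E by move=> Ix; rewrite lee_fin F0.
  apply: (@dual_eq_cvg (fun n => nnsfun_approx mI mEF n) F M) => //.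
  - by move=> n; exact: measurable_funTS.
  - by split => //; exists M.
  - move=> n x Ix; rewrite ger0_norm//.
    rewrite nnsfun_approxE; apply: (@le_trans _ _ (F x)).
      by have := le_approx n F0' Ix; rewrite lee_fin.
    by rewrite (le_trans (ler_norm _))// FM.
  - move=> x Ix; have := cvg_nnsfun_approx mI mEF F0' Ix.
    by move=> /fine_cvgP[].
case: (bG) => mG [M GM].
have -> : G = (fun x => (G x + M) + (- M) * 1) by apply/funext => x; ring.
have bM c : bounded_meas (cst c : R -> R) by exact: bounded_meas_cst.
apply: dual_eqD; [exact: (bounded_measD bG (bM M))|exact: (bM (- M * 1))| |].
- apply: nneg; first exact: (bounded_measD bG (bM M)).
  move=> x Ix; rewrite -lerBlDr sub0r.
  by have := GM x Ix; rewrite ler_norml => /andP[].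
- apply: (@dual_eqZ _ (cst 1)); first exact: bM.
  by apply: nneg; [exact: bM|move=> x _; rewrite ler01].
Qed.

Lemma dual_eq_transfer : is_transfer T f h.
Proof.
split => // g [mg [M gM]].
(* [g] is bounded only almost everywhere. Nonsingularity carries [g = G] a.e. over to the
   compositions with [T]. *)
pose G x := clip `|M| (g x).
have bG : bounded_meas G by exact: bounded_meas_clip.
have gG : ae_eq01 g G.
  apply: (ae_impl gM) => x /= {}gM Ix.
  by rewrite /G clip_id// (le_trans (gM Ix))// ler_norm.
have : EFin (\int[leb]_(x in I) (h x * G x)) =
    EFin (\int[leb]_(x in I) (f x * G (T x))).
  by congr EFin; exact: dual_eq_bounded.
rewrite L1_EFin_Rintegral; last exact: L1h.
rewrite L1_EFin_Rintegral; last exact: L1f.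
have mgT := measurable_nonsingular_comp nsT mg.
have mGT := measurable_nonsingular_comp nsT bG.1.
have mh := L1_measurable Lh; have mf := L1_measurable Lf.
move=> hG; transitivity (\int[leb]_(x in I) (h x * G x)%:E)%E.
  apply: ae_eq_integral => //; try exact/measurable_EFinP/measurable_funM.
    by apply/measurable_EFinP/measurable_funM => //; case: bG.
  by apply: (ae_impl gG) => x /= + Ix => ->.
rewrite hG; apply: ae_eq_integral => //;
  try exact/measurable_EFinP/measurable_funM.
by apply: (ae_impl (nonsingular_ae nsT gG)) => x /= + Ix => ->.
Qed.

End duality.
End Transfer.

Section TransferExists.
Context {R : realType}.
Local Notation leb := (@lebesgue_measure R).
Local Notation I := (@unitI R).
Local Hint Resolve measurable_unitI measurableR_unitI : core.
Implicit Types (T f g h G : R -> R).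

(** The signed measure [f dm] on [I], extended by zero to the whole line. *)
Definition restr_charge f (Lf : L1 f) :
  {charge set (measurableTypeR R) -> \bar R} :=
  induced_charge
    ((@integrable_mkcond _ _ _ leb I (EFin \o f) measurableR_unitI).1 Lf).

Lemma transfer_ex T f : nonsingular T -> L1 f -> exists h, is_transfer T f h.
Proof.
move=> nsT Lf; have [mT TI T0] := nsT.
(* The push-forward needs a map measurable on the whole line; its values off [I] do not matter,
   since the charge has no mass there. *)
have mT' : measurable_fun [set: measurableTypeR R]
    ((T \_ I) : measurableTypeR R -> measurableTypeR R).
  by apply/(measurable_restrictT _ _).1.
pose nu : {charge set (measurableTypeR R) -> \bar R} :=
  measure_function_pushforward__canonical__charge_Charge (restr_charge Lf) mT'.
have nuE A : nu A = (\int[leb]_(x in I `&` (T \_ I) @^-1` A) (f x)%:E)%E.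
  by rewrite integral_mkcondl.
have TIA A : I `&` (T \_ I) @^-1` A = I `&` T @^-1` A.
  apply/seteqP; split => x /= [Ix]; rewrite patchE mem_set//.
have numu : nu `<< leb.
  apply/null_content_dominatesP => A mA A0; rewrite nuE TIA.
  apply: null_set_integral.
  - exact: (mT measurable_unitI A mA).
  - apply: (measurable_funS _ _ (measurable_int leb Lf)) => //.
  - exact: T0.
have := Radon_Nikodym_integrable numu.
have := Radon_Nikodym_fin_num _ numu.
have := fun A => Radon_Nikodym_integral numu (A := A).
move: (Radon_Nikodym nu leb) => k kE kfin intk.
pose h x := fine (k x).
have hk : k = EFin \o h by apply/funext => x /=; rewrite /h fineK.
have Lh : L1 h by rewrite /L1 -hk; exact: integrableS intk.
exists h; apply: dual_eq_transfer => // A mA.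
rewrite /dual_eq /Rintegral; congr fine.
transitivity (\int[leb]_(x in I `&` A) (h x)%:E)%E.
  rewrite integral_mkcondr; apply: eq_integral => x _.
  by rewrite patchE indicE; case: ifP => _; rewrite ?mulr1 ?mulr0.
(* The density is integrated over [I] only, hence [I] meets [A] here. As [T] maps [I] into itself,
   [A] and its trace on [I] have the same preimage in [I]. *)
transitivity (nu (I `&` A)); last first.
  rewrite nuE TIA.
  transitivity (\int[leb]_(x in I `&` T @^-1` A) (f x)%:E)%E.
    congr (integral leb _ _); apply/seteqP; split => x /= [Ix].
      by move=> [].
    by split => //; split => //; exact: TI.
  rewrite integral_mkcondr; apply: eq_integral => x _.
  have -> : (\1_A (T x) : R) = (x \in T @^-1` A)%:R by [].
  rewrite patchE.
  by case: ifP => _; rewrite ?mulr1 ?mulr0.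
rewrite kE; last exact: measurableI.
by rewrite hk.
Qed.

Lemma transferP T f : nonsingular T -> L1 f -> is_transfer T f (transfer T f).
Proof. by move=> nsT Lf; apply: getPex; exact: transfer_ex. Qed.

Lemma transfer_L1 T f : nonsingular T -> L1 f -> L1 (transfer T f).
Proof. by move=> nsT Lf; have [] := transferP nsT Lf. Qed.

Lemma transfer_dual T f G : nonsingular T -> L1 f -> bounded_meas G ->
  \int[leb]_(x in I) (transfer T f x * G x) =
  \int[leb]_(x in I) (f x * G (T x)).
Proof.
move=> nsT Lf bG; have [_ /(_ G)] := transferP nsT Lf.
by rewrite /Rintegral => ->//; exact: bounded_meas_Linfty.
Qed.

Lemma transfer_int T f : nonsingular T -> L1 f ->
  \int[leb]_(x in I) transfer T f x = \int[leb]_(x in I) f x.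
Proof.
move=> nsT Lf; have := transfer_dual nsT Lf (bounded_meas_cst 1).
under eq_Rintegral do rewrite mulr1.
by under [X in _ = X -> _]eq_Rintegral do rewrite mulr1.
Qed.

Lemma transferD T f1 f2 : nonsingular T -> L1 f1 -> L1 f2 ->
  ae_eq01 (transfer T (fun x => f1 x + f2 x))
          (fun x => transfer T f1 x + transfer T f2 x).
Proof.
move=> nsT L1f1 L1f2.
have L12 := L1D L1f1 L1f2.
have Lt1 := transfer_L1 nsT L1f1; have Lt2 := transfer_L1 nsT L1f2.
apply: L1_ae_unique; [exact: transfer_L1|exact: L1D|].
move=> G bG; have bGT := bounded_meas_comp nsT bG.
rewrite transfer_dual//.
under eq_Rintegral do rewrite mulrDl.
under [RHS]eq_Rintegral do rewrite mulrDl.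
rewrite RintegralD//; [|exact: L1M..].
by rewrite RintegralD// ?transfer_dual//; exact: L1M.
Qed.

End TransferExists.

(** * Piecewise expanding maps are nonsingular *)

Section Expanding.
Context {R : realType}.
Local Notation leb := (@lebesgue_measure R).
Local Notation I := (@unitI R).
Local Hint Resolve measurable_unitI measurableR_unitI : core.
Implicit Types (T : R -> R) (D N : set R).

Lemma lebesgue_null_cover N (e : R) : leb N = 0%E -> 0 < e ->
  exists ab : nat -> R * R,
    [/\ forall k, (ab k).1 <= (ab k).2,
        N `<=` \bigcup_k `](ab k).1, (ab k).2[%classic
      & (\sum_(k <oo) ((ab k).2 - (ab k).1)%:E <= e%:E)%E].
Proof.
move=> N0 e0; have := @outer_measure_open_itv_cover R N.
have -> : mu_ext (@wlength R idfun) N = 0%E by exact: N0.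
move=> E; have : (ereal_inf [set (\sum_(k <oo) (@wlength R idfun) (F k))%E |
    F in open_itv_cover N] < e%:E)%E by rewrite -E lte_fin.
move=> /ereal_inf_lt[_ [F [Fitv NF] <-] Fe].
have {Fitv}/choice[ab Fab] : forall k, exists ab : R * R,
    ab.1 <= ab.2 /\ F k = `]ab.1, ab.2[%classic.
  move=> k; have [[a b] /= ->] := Fitv k.
  (* An empty interval is given two equal endpoints, so that all lengths are nonnegative. *)
  have [ab|/ltW ba] := leP a b; first by exists (a, b).
  exists (a, a); split => //=; rewrite !set_itv_ge ?bnd_simp ?ltxx//.
  by rewrite -leNgt.
exists ab; split.
- by move=> k; have [] := Fab k.
- by move=> x /NF[k _]; have [_ ->] := Fab k; exists k.
- apply: le_trans (ltW Fe); apply: lee_nneseries => k _.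
    by rewrite lee_fin subr_ge0; have [] := Fab k.
  have [abk ->] := Fab k; rewrite wlength_itv/= lte_fin.
  case: ltP => [//|ba]; rewrite lee_fin subr_le0//.
Qed.

(** A map that does not shrink distances pulls an interval of length [l] back to a set of diameter
    at most [l]. That set lies in an interval of length [2 l] centered at any of its points, so a
    cover of [N] of total length [e / 2] suffices. *)
Lemma expanding_null T D N : measurable D -> measurable_fun D T ->
  {in D &, forall x y, `|x - y| <= `|T x - T y|} ->
  leb N = 0%E -> measurable N -> leb (D `&` T @^-1` N) = 0%E.
Proof.
move=> mD mT expT N0 mN.
apply/eqP; rewrite eq_le measure_ge0 andbT; apply/lee_addgt0Pr => e e0.
rewrite add0e.

have e20 : 0 < e / 2 by rewrite divr_gt0.
have [ab [leab Nab abe]] := lebesgue_null_cover N0 e20.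
pose E k := D `&` T @^-1` `](ab k).1, (ab k).2[%classic.
have mE k : measurable (E k) by exact: (mT mD _ (measurable_itv _)).
have leE k : (leb (E k) <= (2 * ((ab k).2 - (ab k).1))%:E)%E.
  have [->|/set0P[x0 [Dx0 /=]]] := eqVneq (E k) set0.
    by rewrite measure0 lee_fin mulr_ge0// subr_ge0.
  rewrite in_itv/= => /andP[ax0 x0b].
  set l := (ab k).2 - (ab k).1.
  have l0 : 0 <= l by rewrite subr_ge0.
  apply: (@le_trans _ _ (leb `[x0 - l, x0 + l]%classic)).
    apply: le_measure; rewrite ?inE;
      [exact: mE|exact: (measurable_itv `[x0 - l, x0 + l])|].
    move=> y [Dy /=]; rewrite !in_itv/= => /andP[ay yb].
    rewrite -ler_distlC; apply: (le_trans (expT _ _ _ _)); rewrite ?inE//.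
    by rewrite ler_distlC /l; apply/andP; split; lra.
  rewrite lebesgue_measure_itv/= lte_fin; case: ifP => _; rewrite lee_fin; lra.
apply: (@le_trans _ _ (\sum_(k <oo) leb (E k))%E).
  apply: measure_sigma_subadditive => //; first exact: (mT mD _ mN).
  by move=> x [Dx /= /Nab[k _ abk]]; exists k.
apply: (@le_trans _ _ (\sum_(k <oo) 2%:E * ((ab k).2 - (ab k).1)%:E)%E).
  by apply: lee_nneseries => k _ //; rewrite -EFinM.
rewrite nneseriesZl; last by move=> k _; rewrite lee_fin subr_ge0.
rewrite -(@lee_pdivlMl _ 2)//.
by rewrite -EFinM mulrC.
Qed.

Definition nonsingular_on T D := [/\ measurable D, measurable_fun D T &
  forall N, measurable N -> leb N = 0%E -> leb (D `&` T @^-1` N) = 0%E].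

Lemma nonsingular_on_set1 T a : nonsingular_on T [set a].
Proof.
split => //; first exact: measurable_fun_set1.
move=> N mN N0; apply/eqP; rewrite eq_le measure_ge0 andbT.
have mT : measurable_fun [set a] T by exact: measurable_fun_set1.
rewrite -(lebesgue_measure_set1 a) le_measure ?inE//.
exact: (mT (measurable_set1 a) N mN).
Qed.

Lemma nonsingular_onU T D1 D2 :
  nonsingular_on T D1 -> nonsingular_on T D2 -> nonsingular_on T (D1 `|` D2).
Proof.
move=> [mD1 mT1 T1] [mD2 mT2 T2]; split; first exact: measurableU.
  exact/measurable_funU.
move=> N mN N0; rewrite setIUl measureU0.
- exact: T1.
- exact: (mT1 mD1 N mN).
- exact: (mT2 mD2 N mN).
- exact: T2.
Qed.

(** The partition points are split off as null singletons, because [T] may be discontinuous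
    there. *)
Lemma nonsingular_on_itv_partition T (a b : R) (s : seq R) :
  itv_partition a b s ->
  (forall i, (i < size s)%N ->
     nonsingular_on T `]nth 0 (a :: s) i, nth 0 (a :: s) i.+1[%classic) ->
  nonsingular_on T `[a, b]%classic.
Proof.
elim: s a => [a /itv_partition_nil -> _|c s IH a abs H].
  by rewrite set_itv1; exact: nonsingular_on_set1.
have cbs := itv_partition_cons abs.
have ac : a < c by case: abs => /= /andP[].
have -> : `[a, b]%classic =
    `]a, c[%classic `|` [set a] `|` `[c, b]%classic :> set R.
  apply/seteqP; split => x /=; rewrite !in_itv/=.
    move=> /andP[]; rewrite le_eqVlt => /predU1P[->|ax xb].
      by left; right.
    by have [xc|cx] := ltP x c; [left; left; rewrite ax|right].
  move=> [[/andP[ax xc]|->]|/andP[cx xb]]; have := itv_partition_le cbs;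
    rewrite ?lexx; lra.
apply: nonsingular_onU.
  by apply: nonsingular_onU; [exact: (H 0)|exact: nonsingular_on_set1].
by apply: IH => // i; exact: (H i.+1).
Qed.

Lemma piecewise_expanding_nonsingular T :
  piecewise_expanding T -> nonsingular T.
Proof.
move=> [TI Texp [s s01 Ts]].
suff [_ mT T0] : nonsingular_on T `[0, 1]%classic by split.
apply: (nonsingular_on_itv_partition s01) => i /[dup] si.
move=> /Ts[U [g [oU abU C2g Tg]]].
set a := nth 0 (0 :: s) i in abU Tg *.
set b := nth 0 (0 :: s) i.+1 in abU Tg *.
have si1 : (i < (size s).+1)%N by rewrite ltnW.
have a0 : 0 <= a.
  have := itv_partition_nth_ge si1 s01.
  by rewrite (set_nth_default 0)//=.
have b1 : b <= 1.
  have := itv_partition_nth_le (m := i.+1) si s01.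
  by rewrite (set_nth_default 0)//=.
(* Derivability is local, so inside an open element [T] inherits it from its extension [g]. The mean
   value theorem and [|T'| > 1] then give the distance estimate of [expanding_null]. *)
have nearT x : x \in `]a, b[ -> \forall y \near x, T y = g y.
  by move=> xab; near=> y; apply: Tg; near: y; exact: near_in_itvoo.
have derT x : x \in `]a, b[ -> derivable T x 1.
  move=> xab; apply: (@near_eq_derivable _ _ _ g).
    by near=> y; apply/esym; near: y; exact: nearT.
  have /C2g[] // : U x by apply: abU; rewrite /= subset_itv_oo_cc.
have bigT x : x \in `]a, b[ -> 1 < `|derive1 T x|.
  move=> xab; rewrite -lte_fin; apply: (lt_le_trans Texp).
  apply: ereal_inf_lbound.
  exists x => //=; split; last exact: derT.
  move: xab; rewrite in_itv/= => /andP[ax xb].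
  by rewrite (le_lt_trans a0 ax) (lt_le_trans xb b1).
have mab : measurable (`]a, b[%classic : set R) by exact: measurable_itv.
have mT : measurable_fun `]a, b[%classic T.
  apply: subspace_continuous_measurable_fun => //.
  exact: derivable_within_continuous.
split => // N mN N0; apply: expanding_null => //.
move=> x y; wlog xy : x y / x < y => [H|].
  have [/H//|/H {}H xab yab|->] := ltgtP x y; last by rewrite !subrr.
  by rewrite distrC (distrC (T x)) H.
rewrite !inE/= => xab yab.
have sub z : z \in `[x, y] -> z \in `]a, b[.
  by move: xab yab; rewrite !in_itv/=; lra.
have [z||c cxy Txy] := @MVT _ T (derive1 T) x y xy.
- move=> zxy; apply: DeriveDef; first by apply/derT/sub/subset_itv_oo_cc.
  by rewrite derive1E.
- by apply: derivable_within_continuous => z zxy; exact/derT/sub.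
rewrite (distrC (T x)) Txy normrM distrC ler_peMl// ltW// bigT//; apply: sub.
exact: subset_itv_oo_cc.
Unshelve. all: by end_near. Qed.

End Expanding.

(** * Functions of bounded variation *)

Section BoundedVariation.
Context {R : realType}.
Local Notation leb := (@lebesgue_measure R).
Local Notation I := (@unitI R).
Local Notation TV := (@total_variation R 0 1).
Local Hint Resolve measurable_unitI measurableR_unitI : core.
Implicit Types (f g F G : R -> R).

Lemma L1norm_ge0 f : (0 <= L1norm f)%E.
Proof. by apply: integral_ge0 => x _; rewrite lee_fin. Qed.

Lemma L1normE f : L1 f -> L1norm f = (\int[leb]_(x in I) `|f x|)%:E.
Proof. by move=> Lf; rewrite (L1_EFin_Rintegral (integrable_norm Lf)). Qed.

Lemma ess_variation_ge0 f : (0 <= ess_variation f)%E.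
Proof.
by apply: le_ereal_inf_tmp => _ [g _ <-]; exact: total_variation_ge0 ler01.
Qed.

Lemma BVnorm_ge0 f : (0 <= BVnorm f)%E.
Proof. by rewrite adde_ge0// ?L1norm_ge0// ess_variation_ge0. Qed.

Lemma BVnorm_BV f (A : R) : L1 f -> (BVnorm f <= A%:E)%E -> BV f.
Proof.
move=> Lf fA; split => //; apply: le_lt_trans (ltry A).
by apply: le_trans fA; rewrite leeDl// L1norm_ge0.
Qed.

Lemma BV_lt f : BV f -> exists2 A : R, 0 < A & (BVnorm f < A%:E)%E.
Proof.
move=> [Lf Vf]; have : (BVnorm f < +oo)%E.
  by rewrite lte_add_pinfty// L1normE// ltry.
move: (BVnorm_ge0 f); case: (BVnorm f) => // n n0 _.
exists (n + 1); last by rewrite lte_fin ltrDl.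
by rewrite ltr_wpDl// -lee_fin.
Qed.

Lemma total_variation_diff F (v x y : R) : TV F = v%:E -> I x -> I y ->
  `|F x - F y| <= v.
Proof.
move=> FV; wlog xy : x y / x <= y => [H Ix Iy|].
  by have [/H|/ltW /H] := leP x y; [|rewrite distrC]; apply.
rewrite /unitI/= !in_itv/= => /andP[x0 x1] /andP[y0 y1].
rewrite -lee_fin -FV (total_variationD F x0 x1) (total_variationD F xy y1).
rewrite distrC; apply: (le_trans (total_variation_ge F xy)).
by rewrite addeCA leeDl// adde_ge0// total_variation_ge0.
Qed.

(** The strict inequality yields a representative whose variation [v] satisfies [v + ||f||_1 < A].
    Averaging [|F x| <= |F y| + v] over [y] bounds [F] at every point by that same sum. *)
Lemma BV_representative f (A : R) : L1 f -> (BVnorm f < A%:E)%E ->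
  exists F (v : R), [/\ ae_eq01 F f, TV F = v%:E, 0 <= v, v <= A
    & forall x, I x -> `|F x| <= A].
Proof.
move=> Lf; rewrite /BVnorm L1normE//; set n := \int[leb]_(x in I) `|f x|.
have n0 : 0 <= n by exact: Rintegral_ge0.
rewrite -lteBrDr// => /ereal_inf_lt[_ [F Ff <-]] FA.
have := total_variation_ge0 F (@ler01 R).
move: FA; case TVF : (TV F) => [v||]//; rewrite -EFinB lte_fin lee_fin => vA v0.
exists F, v; split => //; first lra.
move=> x Ix; apply: (@le_trans _ _ (v + n)); last lra.
rewrite -lerBlDl -[leLHS]Rintegral_unitI_cst; apply: ae_le_Rintegral.
- exact: L1_cst.
- exact: integrable_norm Lf.
- apply: (ae_impl Ff) => y /= + Iy => <-//.
  have := total_variation_diff TVF Ix Iy.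
  by have := ler_distD (F y) (F x) 0; rewrite !subr0; lra.
Qed.

Lemma BV_ae_bounded f (A : R) : L1 f -> (BVnorm f < A%:E)%E ->
  {ae leb, forall x, I x -> `|f x| <= A}.
Proof.
move=> Lf /(BV_representative Lf)[F [v [Ff _ _ _ FA]]].
by apply: (ae_impl Ff) => x /= + Ix => <-//; exact: FA.
Qed.

(** The discrete Leibniz rule, summed over a subdivision. *)
Lemma total_variation_shiftM F G (c A B v w : R) :
  (forall x, I x -> `|F x| <= A) -> (forall x, I x -> `|G x| <= B) ->
  0 <= A -> 0 <= B ->
  TV F = v%:E -> TV G = w%:E ->
  (TV (fun x => (F x - c)%R * G x)%R <= (((A + `|c|) * w + B * v)%R)%:E)%E.
Proof.
move=> FA GB A0 B0 TVF TVG; apply: ge_ereal_sup => _ [_ [s s01 <-] <-].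
rewrite lee_fin.
have le_TV H (t : R) : TV H = t%:E -> variation 0 1 H s <= t.
  move=> TVH; rewrite -lee_fin -TVH; apply: ereal_sup_ubound.
  by exists (variation 0 1 H s) => //; exists s.
apply: (@le_trans _ _ ((A + `|c|) * variation 0 1 G s + B * variation 0 1 F s)).
  rewrite /variation !mulr_sumr -big_split/= !big_nat.
  apply: ler_sum => i /andP[_ si].
  have I_ k : (k < (size s).+1)%N -> I (nth 1 (0 :: s) k).
    move=> ks; rewrite /unitI/= in_itv/= (itv_partition_nth_ge ks s01).
    exact: (itv_partition_nth_le ks s01).
  have Ii : I (nth 1 (0 :: s) i) by apply: I_; rewrite ltnW.
  have Ii1 : I (nth 1 s i) by exact: (I_ i.+1).
  move: (nth 1 (0 :: s) i) (nth 1 s i) Ii Ii1 => x y Ix Iy.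
  rewrite [X in `|X|](_ : _ =
    (F y - c) * (G y - G x) + G x * (F y - F x)); last by ring.
  rewrite (le_trans (ler_normD _ _))// !normrM lerD// ler_wpM2r//;
    last exact: GB.
  by rewrite (le_trans (ler_normB _ _))// lerD2r FA.
by rewrite lerD// ler_wpM2l// ?addr_ge0//; exact: le_TV.
Qed.

(** The first two terms of the bound control the variation, the third the L^1 norm through the sup
    bounds. It serves for [f_k g_k], with [c] the mean at time [k]. *)
Lemma BV_shiftM f g (c A B : R) : L1 f -> L1 g ->
  (BVnorm f < A%:E)%E -> (BVnorm g < B%:E)%E ->
  L1 (fun x => (f x - c) * g x) /\
  (BVnorm (fun x => (f x - c) * g x)%R
     <= ((A + `|c|) * B + B * A + (A + `|c|) * B)%:E)%E.
Proof.
move=> Lf Lg fA gB.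
have [F [v [Ff TVF v0 vA FA]]] := BV_representative Lf fA.
have [G [w [Gg TVG w0 wB GB]]] := BV_representative Lg gB.
have A0 : 0 <= A by lra.
have B0 : 0 <= B by lra.
have mfg : measurable_fun I (fun x => (f x - c) * g x).
  apply: measurable_funM; last exact: L1_measurable.
  by apply: measurable_funB => //; exact: L1_measurable.
have FGfg : ae_eq01 (fun x => (F x - c) * G x) (fun x => (f x - c) * g x).
  by apply: (ae_impl2 Ff Gg) => x /= Ff' Gg' Ix; rewrite Ff'// Gg'.
have bfg : {ae leb, forall x, I x -> `|(f x - c) * g x| <= (A + `|c|) * B}.
  apply: (ae_impl FGfg) => x /= + Ix => <-//.
  rewrite normrM ler_pM//; last exact: GB.
  by rewrite (le_trans (ler_normB _ _))// lerD2r FA.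
have Lfg := ae_bounded_L1 mfg bfg.
split => //; rewrite /BVnorm EFinD leeD//.
  apply: (@le_trans _ _ (TV (fun x => (F x - c) * G x))).
    by apply: ereal_inf_lbound; exists (fun x => (F x - c) * G x).
  apply: le_trans (total_variation_shiftM c FA GB A0 B0 TVF TVG) _.
  by rewrite lee_fin lerD// ler_wpM2l// ?addr_ge0.
rewrite L1normE// lee_fin.
rewrite -[leRHS]Rintegral_unitI_cst; apply: ae_le_Rintegral => //.
- exact: integrable_norm Lfg.
- exact: L1_cst.
Qed.

End BoundedVariation.

(** * An Azuma-type exponential estimate *)

Section Azuma.
Context {R : realType}.
Local Notation leb := (@lebesgue_measure R).
Local Notation I := (@unitI R).
Local Hint Resolve measurable_unitI measurableR_unitI : core.
Implicit Types (f g h G : R -> R).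

(* Replaces Hoeffding's lemma, at the cost of a worse constant: integrated
   against [lam * U] with [U] centered and [`|U| <= M], it gives
   [int expR (lam * U) <= expR (2 * (lam * M) ^+ 2)]. *)
Lemma expR_le_addr_expR_sqr (y : R) : expR y <= y + expR (2 * y ^+ 2).
Proof.
(* Above 1/2, [y <= 2 y^2]. Below, [expR y <= 1 / (1 - y) <= 1 + y + 2 y^2], the last step because
   the product of [1 - y] and [1 + y + 2 y^2] exceeds 1 by [y^2 (1 - 2 y)]. *)
have [y2|y2] := leP y 2^-1; last first.
  apply: (@le_trans _ _ (expR (2 * y ^+ 2))); last by rewrite lerDr; lra.
  by rewrite ler_expR; nra.
have y1 : 0 < 1 - y by lra.
apply: (@le_trans _ _ (y + (1 + 2 * y ^+ 2))); last first.
  by rewrite lerD2l expR_ge1Dx.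
apply: (@le_trans _ _ (1 - y)^-1).
  by rewrite -lef_pV2 ?posrE ?expR_gt0 ?invr_gt0// invrK -expRN expR_ge1Dx.
rewrite -[leLHS]div1r ler_pdivrMr//.
rewrite -subr_ge0 (_ : _ - 1 = y ^+ 2 * (1 - 2 * y)); last by ring.
by rewrite mulr_ge0 ?sqr_ge0//; lra.
Qed.

(** In the bound of the exponential by [lam U + q], orthogonality kills the linear term; duality
    then transfers the remaining weight from [g] to [g']. *)
Lemma azuma_step (T g g' U : R -> R) (M lam : R) :
  nonsingular T -> L1 g -> {ae leb, forall x, I x -> 0 <= g x} ->
  measurable_fun I U -> (forall x, I x -> `|U x| <= M) ->
  (forall G, bounded_meas G ->
     \int[leb]_(x in I) (g' x * G x) = \int[leb]_(x in I) (g x * G (T x))) ->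
  (forall G, bounded_meas G ->
     \int[leb]_(x in I) (g x * (U x * G (T x))) = 0) ->
  forall G, bounded_meas G -> (forall x, I x -> 0 <= G x) ->
  \int[leb]_(x in I) (g x * (expR (lam * U x) * G (T x)))
    <= expR (2 * (lam * M) ^+ 2) * \int[leb]_(x in I) (g' x * G x).
Proof.
move=> nsT Lg g0 mU UM dual ort G bG G0.
have bU : bounded_meas U by split => //; exists M.
have bGT := bounded_meas_comp nsT bG.
have bUG := bounded_measM bU bGT.
have TI : forall x, I x -> I (T x) by case: nsT.
set q := expR _.
have bexp : bounded_meas (fun x => expR (lam * U x) * G (T x)).
  apply: bounded_measM => //; apply: bounded_meas_expR.
  by apply: bounded_measM => //; exact: bounded_meas_cst.
have LgUG : L1 (fun x => lam * (g x * (U x * G (T x)))).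
  have := L1M (L1M Lg bUG) (bounded_meas_cst lam).
  by under eq_fun do rewrite mulrC.
have LgG : L1 (fun x => q * (g x * G (T x))).
  have := L1M (L1M Lg bGT) (bounded_meas_cst q).
  by under eq_fun do rewrite mulrC.
apply: (@le_trans _ _ (\int[leb]_(x in I)
    (lam * (g x * (U x * G (T x))) + q * (g x * G (T x))))); last first.
  rewrite RintegralD// RintegralZl//; last exact: L1M.
  by rewrite ort// mulr0 add0r RintegralZl// ?dual//; exact: L1M.
apply: ae_le_Rintegral; [exact: L1M|exact: L1D|].
apply: (ae_impl g0) => x /= {}g0 Ix.
rewrite [leRHS](_ : _ = g x * ((lam * U x + q) * G (T x))); last by ring.
rewrite ler_wpM2l ?g0// ler_wpM2r ?G0//; first exact: TI.
apply: (le_trans (expR_le_addr_expR_sqr _)).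
rewrite lerD2l ler_expR ler_wpM2l// !exprMn ler_wpM2l ?sqr_ge0//.
by rewrite -(real_normK (num_real (U x))) lerXn2r ?nnegrE// ?UM//
  (le_trans _ (UM _ Ix)).
Qed.

(* [expR (lam * sum_(k < n) U_(j+k) (T_(j+1)^(j+k) x))], unfolded from the
   innermost map so that [azuma_step] removes one factor at a time. *)
Fixpoint exp_sum (lam : R) (T U : nat -> R -> R) (n j : nat) (x : R) : R :=
  if n is m.+1 then
    expR (lam * U j x) * exp_sum lam T U m j.+1 (T j.+1 x)
  else 1.

Lemma exp_sum_ge0 lam T U n j x : 0 <= exp_sum lam T U n j x.
Proof. by elim: n j x => //= n IH j x; rewrite mulr_ge0// expR_ge0. Qed.

Lemma index_iota1S k :
  index_iota 1 k.+2 = index_iota 1 k.+1 ++ [:: k.+1].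
Proof. by rewrite /index_iota !subSS !subn0 -[in LHS](addn1 k) iotaD add1n. Qed.

Lemma seq_mapS (T : nat -> R -> R) k x :
  seq_map T 1 k.+1 x = T k.+1 (seq_map T 1 k x).
Proof. by rewrite /seq_map index_iota1S foldl_cat. Qed.

Lemma seq_transferS (T : nat -> R -> R) k f :
  seq_transfer T 1 k.+1 f = transfer (T k.+1) (seq_transfer T 1 k f).
Proof. by rewrite /seq_transfer index_iota1S foldl_cat. Qed.

(** The later block is reindexed to start at 1, the form in which (D_r) and (Dec) are stated. *)
Lemma seq_transferD (T : nat -> R -> R) m r f : seq_transfer T 1 (m + r) f =
  seq_transfer (fun i => T (m + i)%N) 1 r (seq_transfer T 1 m f).
Proof.
by elim: r => [|r IH]; rewrite ?addn0// addnS !seq_transferS IH addnS.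
Qed.

Lemma exp_sumE lam T U n j x : exp_sum lam T U n j (seq_map T 1 j x) =
  expR (lam * \sum_(k < n) U (j + k)%N (seq_map T 1 (j + k) x)).
Proof.
elim: n j => [|n IH] j; first by rewrite big_ord0 mulr0 expR0.
rewrite /= -seq_mapS IH big_ord_recl addn0 mulrDr expRD.
congr (_ * expR (_ * _)).
by apply: eq_bigr => k _; rewrite lift0 addSnnS.
Qed.

Section azuma.
Variables (T g U : nat -> R -> R) (M lam : R).
Hypotheses (nsT : forall k, nonsingular (T k.+1)) (Lg : forall k, L1 (g k))
  (g0 : forall k, {ae leb, forall x, I x -> 0 <= g k x})
  (mU : forall k, measurable_fun I (U k))
  (UM : forall k x, I x -> `|U k x| <= M)
  (dual : forall k G, bounded_meas G -> \int[leb]_(x in I) (g k.+1 x * G x) =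
     \int[leb]_(x in I) (g k x * G (T k.+1 x)))
  (ort : forall k G, bounded_meas G ->
     \int[leb]_(x in I) (g k x * (U k x * G (T k.+1 x))) = 0).

Lemma bounded_meas_exp_sum n j : bounded_meas (exp_sum lam T U n j).
Proof.
elim: n j => [|n IH] j /=; first exact: bounded_meas_cst.
apply: bounded_measM; last exact: bounded_meas_comp.
apply: bounded_meas_expR; apply: bounded_measM; first exact: bounded_meas_cst.
by split => //; exists M => x Ix; exact: UM.
Qed.

Lemma azuma n j : \int[leb]_(x in I) (g j x * exp_sum lam T U n j x)
  <= expR (2 * (lam * M) ^+ 2) ^+ n * \int[leb]_(x in I) g (j + n)%N x.
Proof.
elim: n j => [|n IH] j.
  by rewrite expr0 mul1r addn0; under eq_Rintegral do rewrite mulr1.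
rewrite /=; apply: le_trans.
  apply: (azuma_step lam (nsT j) (Lg j) (g0 j) (mU j) (@UM j) (@dual j)
    (@ort j) (bounded_meas_exp_sum n j.+1)).
  by move=> x _; exact: exp_sum_ge0.
rewrite [_ ^+ n.+1]exprS -mulrA addnS -addSn.
by apply: ler_wpM2l; [exact: expR_ge0|exact: IH].
Qed.

End azuma.
End Azuma.

(** * Sequential transfer operators *)

Section Densities.
Context {R : realType}.
Local Notation leb := (@lebesgue_measure R).
Local Notation I := (@unitI R).
Local Hint Resolve measurable_unitI measurableR_unitI : core.
Implicit Types (f g h G : R -> R) (T : nat -> R -> R).

Lemma Rintegral_le_bound G (M : R) : bounded_meas G ->
  (forall x, I x -> `|G x| <= M) -> `|\int[leb]_(x in I) G x| <= M.
Proof.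
move=> /bounded_meas_L1 LG GM.
apply: (le_trans (le_normr_Rintegral _ LG)) => //.
rewrite -[leRHS]Rintegral_unitI_cst; apply: le_Rintegral => //.
- exact: integrable_norm LG.
- exact: L1_cst.
Qed.

Lemma seq_map_nonsingular T k : (forall i, nonsingular (T i.+1)) ->
  nonsingular (seq_map T 1 k).
Proof.
move=> nsT; elim: k => [|k [mS SI S0]].
  split; [exact: measurable_id|by []|move=> N mN N0].
  apply/eqP; rewrite eq_le measure_ge0 andbT -N0 le_measure ?inE//.
  exact: measurableI.
have [mT TI T0] := nsT k.
have mST : measurable_fun I (seq_map T 1 k.+1).
  have -> : seq_map T 1 k.+1 = T k.+1 \o seq_map T 1 k.
    by apply/funext => x; rewrite seq_mapS.
  apply: (measurable_comp measurable_unitI _ mT mS) => _ [x Ix <-].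
  exact: SI.
split => //.
  by move=> x Ix; rewrite seq_mapS; apply: TI; exact: SI.
move=> N mN N0.
have mTN : measurable (I `&` T k.+1 @^-1` N).
  exact: (mT measurable_unitI N mN).
rewrite -(S0 _ mTN (T0 _ mN N0)); congr (leb _).
apply/seteqP; split => x /= [Ix]; rewrite seq_mapS; last by move=> [].
by split => //; split => //; exact: SI.
Qed.

Lemma seq_transfer_L1 T k f : (forall i, nonsingular (T i.+1)) -> L1 f ->
  L1 (seq_transfer T 1 k f).
Proof.
move=> nsT Lf; elim: k => [//|k IH].
by rewrite seq_transferS; exact: transfer_L1.
Qed.

Lemma seq_transfer_dual T k f G : (forall i, nonsingular (T i.+1)) -> L1 f ->
  bounded_meas G ->
  \int[leb]_(x in I) (seq_transfer T 1 k f x * G x) =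
  \int[leb]_(x in I) (f x * G (seq_map T 1 k x)).
Proof.
move=> nsT Lf; elim: k G => [//|k IH] G bG.
rewrite seq_transferS transfer_dual//; last exact: seq_transfer_L1.
rewrite IH; last exact: bounded_meas_comp.
by under [RHS]eq_Rintegral do rewrite seq_mapS.
Qed.

Lemma seq_transfer_int T k f : (forall i, nonsingular (T i.+1)) -> L1 f ->
  \int[leb]_(x in I) seq_transfer T 1 k f x = \int[leb]_(x in I) f x.
Proof.
move=> nsT Lf; elim: k => [//|k IH].
by rewrite seq_transferS transfer_int//; exact: seq_transfer_L1.
Qed.

Lemma transfer_sum (S : R -> R) n (F : nat -> R -> R) : nonsingular S ->
  (forall k, (k < n)%N -> L1 (F k)) ->
  ae_eq01 (transfer S (fun x => \sum_(k < n) F k x))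
          (fun x => \sum_(k < n) transfer S (F k) x).
Proof.
move=> nsS; elim: n => [|n IH] LF.
  under [X in transfer S X]funext do rewrite big_ord0.
  under [X in ae_eq01 _ X]funext do rewrite big_ord0.
  apply: L1_ae_unique; [exact/transfer_L1/L1_cst|exact: L1_cst|].
  move=> G bG; rewrite transfer_dual//; last exact: L1_cst.
  under eq_Rintegral do rewrite mul0r.
  by under [RHS]eq_Rintegral do rewrite mul0r.
under [X in transfer S X]funext do rewrite big_ord_recr/=.
under [X in ae_eq01 _ X]funext do rewrite big_ord_recr/=.
have LFn k : (k < n)%N -> L1 (F k) by move=> kn; apply: LF; rewrite ltnW.
apply: (ae_eq01_trans (transferD nsS (L1_sum LFn) (LF n (ltnSn n)))).
by apply: (ae_impl (IH LFn)) => x /= + Ix => ->.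
Qed.

Lemma BVnorm_cst1 : (BVnorm (@cst R R 1%R) <= 1%:E)%E.
Proof.
rewrite /BVnorm L1normE; last exact: L1_cst.
under eq_Rintegral do rewrite normr1.
rewrite (Rintegral_unitI_cst 1) -[leRHS]add0e leeD2r//.
apply: (@le_trans _ _ (total_variation 0 1 (cst 1 : R -> R))).
  by apply: ereal_inf_lbound; exists (cst 1) => //; exact: aeW.
by rewrite nondecreasing_total_variation ?ler01// subrr.
Qed.

Lemma BVnorm_density_bound (C : set (R -> R)) r T :
  (forall S, C S -> nonsingular S) -> (1 <= r)%N -> cond_D r C ->
  (forall n, (1 <= n)%N -> C (T n)) ->
  (forall k, {ae leb, forall x, I x -> 0 <= seq_transfer T 1 k (cst 1) x}) ->
  exists2 B : R, 0 < B &
    forall k, (BVnorm (seq_transfer T 1 k (cst 1%R)) < B%:E)%E.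
Proof.
move=> nsC r1 [rho [M0 [Cr [/andP[rho0 rho1] M00 Cr0 D1 Dr]]]] CT g0.
pose g k := seq_transfer T 1 k (cst 1).
have nsT i : nonsingular (T i.+1) by apply/nsC/CT.
have Lg k : L1 (g k) by apply: seq_transfer_L1 => //; exact: L1_cst.
have g1 k : L1norm (g k) = 1%E.
  rewrite L1normE//; congr EFin.
  transitivity (\int[leb]_(x in I) g k x); last first.
    by rewrite seq_transfer_int ?Rintegral_unitI_cst//; exact: L1_cst.
  apply: ae_Rintegral; [exact: L1_measurable (integrable_norm (Lg k))| |].
    exact: L1_measurable.
  by apply: (ae_impl (g0 k)) => x /= + Ix => gx; rewrite ger0_norm// gx.
(* With [b >= 1] the powers increase, so [b ^+ r] covers every time before [r], where only the
   one-step bound is available. *)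
pose b := Num.max 1 M0.
have b1 : 1 <= b by rewrite le_max lexx.
have small k : (BVnorm (g k) <= (b ^+ k)%:E)%E.
  elim: k => [|k IH]; first exact: BVnorm_cst1.
  rewrite /g seq_transferS; apply: (le_trans (D1 _ _ (CT _ _) _)) => //.
    exact: BVnorm_BV IH.
  rewrite exprS EFinM; apply: lee_pmul => //; [exact: ltW|exact: BVnorm_ge0|].
  by rewrite lee_fin le_max lexx orbT.
(* Chosen to be stable under [B -> rho B + Cr], the recursion over blocks of length [r]. *)
pose B := b ^+ r + Cr / (1 - rho).
have rho1' : 0 < 1 - rho by rewrite subr_gt0.
have BCr : rho * B + Cr <= B.
  rewrite -subr_ge0 (_ : _ - _ = (1 - rho) * b ^+ r); last first.
    by rewrite /B; field; rewrite gt_eqF.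
  by rewrite mulr_ge0 ?exprn_ge0 ?(ltW rho1')// (le_trans ler01).
have large k : (BVnorm (g k) <= B%:E)%E.
  elim/ltn_ind: k => k IH; have [kr|rk] := ltnP k r.
    apply: (le_trans (small k)); rewrite lee_fin /B.
    apply: (@le_trans _ _ (b ^+ r)); first by rewrite ler_weXn2l// ltnW.
    by rewrite lerDl divr_ge0// ltW.
  have mk : (k - r < k)%N by rewrite ltn_subrL (leq_trans r1 rk) r1.
  rewrite /g -(subnK rk) seq_transferD.
  apply: (le_trans (Dr (fun i => T (k - r + i)%N) (g (k - r)%N) _ _)).
  - by move=> i /andP[i1 _]; apply: CT; rewrite (leq_trans i1)// leq_addl.
  - exact: BVnorm_BV (IH _ mk).
  - rewrite g1 mule1; apply: (@le_trans _ _ (rho%:E * B%:E + Cr%:E)%E).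
      by rewrite leeD2r// lee_wpmul2l ?lee_fin ?(ltW rho0)// IH.
    by rewrite -EFinM -EFinD lee_fin.
(* The extra 1 gives the strict inequality that [BV_representative] needs. *)
exists (B + 1); last first.
  by move=> k; rewrite (le_lt_trans (large k))// lte_fin ltrDl.
by rewrite ltr_wpDl// -lee_fin; apply: le_trans (BVnorm_ge0 _) (large 0).
Qed.

End Densities.

(** * The corrector *)

Section Corrector.
Context {R : realType}.
Local Notation leb := (@lebesgue_measure R).
Local Notation I := (@unitI R).
Local Hint Resolve measurable_unitI measurableR_unitI : core.
Variables T phi : nat -> R -> R.

(* [P_(i+1)^(i+l) (phi_i)] *)
Definition pushed (i l : nat) : R -> R :=
  seq_transfer (fun j => T (i + j)%N) 1 l (phi i).

Definition corrector (k : nat) (x : R) : R := \sum_(i < k) pushed i (k - i) x.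

Hypotheses (nsT : forall k, nonsingular (T k.+1)) (Lphi : forall k, L1 (phi k)).

Lemma pushed_L1 i l : L1 (pushed i l).
Proof. by apply: seq_transfer_L1 => // j; rewrite addnS. Qed.

Lemma pushedS i l : pushed i l.+1 = transfer (T (i + l).+1) (pushed i l).
Proof. by rewrite /pushed seq_transferS addnS. Qed.

Lemma corrector_L1 k : L1 (corrector k).
Proof.
by apply: (@L1_sum _ k (fun i => pushed i (k - i))) => i _; exact: pushed_L1.
Qed.

Lemma correctorS k : ae_eq01 (corrector k.+1)
  (transfer (T k.+1) (fun x => phi k x + corrector k x)).
Proof.
apply: ae_eq01_sym.
apply: (ae_eq01_trans (transferD (nsT k) (Lphi k) (corrector_L1 k))).
have := @transfer_sum _ (T k.+1) k (fun i => pushed i (k - i)) (nsT k)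
  (fun i _ => pushed_L1 i (k - i)).
move/ae_impl; apply => x /= + Ix => /(_ Ix) tE.
rewrite [X in _ + X]tE /corrector big_ord_recr/= subSnn.
rewrite [in RHS]addrC; congr (_ + _).
  by rewrite pushedS addn0.
apply: eq_bigr => i _.
by rewrite subSn ?(ltnW (ltn_ord i))// pushedS subnKC// ltnW.
Qed.

Lemma geometric_tail_le (theta : R) k : 0 < theta < 1 ->
  \sum_(i < k) theta ^+ (k - i) <= (1 - theta)^-1.
Proof.
move=> /andP[t0 t1]; have t1' : 0 < 1 - theta by rewrite subr_gt0.
elim: k => [|k IH]; first by rewrite big_ord0 invr_ge0 ltW.
rewrite big_ord_recr/= subSnn expr1.
(* The sums satisfy [S_(k+1) = theta S_k + theta]. *)
under eq_bigr => i _ do rewrite subSn ?(ltnW (ltn_ord i))// exprS.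
rewrite -mulr_sumr; apply: (@le_trans _ _ (theta * (1 - theta)^-1 + theta)).
  by rewrite lerD2r ler_pM2l.
rewrite -subr_ge0 (_ : _ - _ = (1 - theta) ^+ 2 / (1 - theta)); last first.
  by field; rewrite gt_eqF.
by rewrite divr_ge0 ?sqr_ge0// ltW.
Qed.

Lemma corrector_bound (K theta : R) k : 0 <= K -> 0 < theta < 1 ->
  (forall i l, (1 <= l)%N ->
    {ae leb, forall x, I x -> `|pushed i l x| <= K * theta ^+ l}) ->
  {ae leb, forall x, I x -> `|corrector k x| <= K / (1 - theta)}.
Proof.
move=> K0 t01 pK.
(* One null set outside which the bounds for all [i] hold together. *)
have : {ae leb, forall x, forall i, I x -> (i < k)%N ->
    `|pushed i (k - i) x| <= K * theta ^+ (k - i)}.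
  apply: ae_foralln => i; have [ik|ki] := ltnP i k; last exact: aeW.
  have ik1 : (1 <= k - i)%N by rewrite subn_gt0.
  by apply: (ae_impl (pK i (k - i)%N ik1)) => x /= + Ix _; exact.
move/ae_impl; apply => x /= xK Ix; rewrite (le_trans (ler_norm_sum _ _ _))//.
apply: (@le_trans _ _ (\sum_(i < k) K * theta ^+ (k - i))).
  by apply: ler_sum => i _; exact: xK.
by rewrite -mulr_sumr ler_wpM2l// geometric_tail_le.
Qed.

End Corrector.

(** * Markov's inequality and the concentration bound *)

Section Concentration.
Context {R : realType}.
Local Notation leb := (@lebesgue_measure R).
Local Notation I := (@unitI R).
Local Hint Resolve measurable_unitI measurableR_unitI : core.
Implicit Types (F G : R -> R).

(** Inclusion in the level set up to a null set is what the application provides, where [f] agrees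
    with its truncation only almost everywhere; monotonicity of the outer measure absorbs the
    exceptional set. *)
Lemma markov_unitI G (a b : R) (X : set R) : bounded_meas G ->
  (forall x, I x -> 0 <= G x) -> 0 < a -> \int[leb]_(x in I) G x <= b ->
  {ae leb, forall x, X x -> I x /\ a <= G x} -> (leb X <= (b / a)%:E)%E.
Proof.
move=> bG G0 a0 Gb [N [mN N0 XN]].
pose Y := I `&` [set x | a <= G x].
have mG := bG.1.
have mY : measurable (Y : set R).
  rewrite /Y (_ : [set x | a <= G x] = G @^-1` `[a, +oo[%classic).
    exact: (mG measurable_unitI _ (measurable_itv _)).
  by apply/seteqP; split => x /=; rewrite in_itv/= andbT.
have : (leb X <= leb (Y `|` N))%E.
  apply: (le_outer_measure (mu_ext (@wlength R idfun))) => x Xx.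
  have [[Ix aG]|nY] := pselect (I x /\ a <= G x); first by left.
  by right; apply: XN => /= /(_ Xx).
rewrite measureU0// => /le_trans; apply.
rewrite mulrC EFinM lee_pdivlMl//.
rewrite -integral_cst//; move: Gb; rewrite -lee_fin; apply: le_trans.
rewrite L1_EFin_Rintegral; last exact: bounded_meas_L1.
apply: (@le_trans _ _ (\int[leb]_(x in Y) (G x)%:E)%E).
  apply: ge0_le_integral => //.
  - by move=> x _; rewrite lee_fin ltW.
  - apply/measurable_EFinP.
    exact: (measurable_funS measurable_unitI (@subIsetl _ _ _) mG).
  - by move=> x [].
apply: ge0_subset_integral => //.
- exact/measurable_EFinP.
- exact: subIsetl.
Qed.

End Concentration.

Theorem proposition13 (R : realType) (C : set (R -> R)) (r : nat)
    (T : nat -> R -> R) :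
  (forall S : R -> R, C S -> piecewise_expanding S) ->
  (1 <= r)%N -> cond_D r C -> cond_Dec C ->
  (forall n, (1 <= n)%N -> C (T n)) ->
  cond_Min T ->
  forall f : R -> R, BV f ->
  exists2 tau : R, 0 < tau &
    forall t : R, 0 < t ->
    exists2 K : R, 0 < K &
      forall n : nat, (1 <= n)%N ->
      (lebesgue_measure
         [set x : R | unitI x /\
            (n%:R^-1 * (\sum_(0 <= k < n)
              (f (seq_map T 1 k x)
               - \int[lebesgue_measure]_(y in @unitI R)
                   f (seq_map T 1 k y))) > t)%R]
       <= (K * expR (- (tau * n%:R * t ^+ 2)))%:E)%E.
Proof.
move=> pe r1 D [theta [K0 [t01 K00 Dec]]] CT [delta0 d00 Min] f BVf.
pose leb := @lebesgue_measure R; pose I := @unitI R.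
have [mI mI'] := (@measurable_unitI R, @measurableR_unitI R).
have nsC S : C S -> nonsingular S.
  by move=> /pe; exact: piecewise_expanding_nonsingular.
have nsT k : nonsingular (T k.+1) by apply/nsC/CT.
have nsTk k := seq_map_nonsingular k nsT.
pose g k := seq_transfer T 1 k (cst 1).
have Lg k : L1 (g k) by apply: seq_transfer_L1 => //; exact: L1_cst.
(* (Min) speaks of times [n >= 1]; the minimum with 1 includes [g 0 = 1]. *)
pose delta := Num.min 1 delta0.
have d0 : 0 < delta by rewrite lt_min ltr01.
have gd k : {ae leb, forall x, I x -> delta <= g k x}.
  case: k => [|k]; first by apply: aeW => x _; rewrite ge_min lexx.
  apply: (ae_impl (Min k.+1 isT)) => x /= + Ix => /(_ Ix); apply: le_trans.
  by rewrite ge_min lexx orbT.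
have g0 k : {ae leb, forall x, I x -> 0 <= g k x}.
  by apply: (ae_impl (gd k)) => x /= + Ix => /(_ Ix); apply/le_trans/ltW.
have gint k : \int[leb]_(x in I) g k x = 1.
  by rewrite seq_transfer_int ?Rintegral_unitI_cst//; exact: L1_cst.
have [B B0 gB] := BVnorm_density_bound nsC r1 D CT g0.
have [A A0 fA] := BV_lt BVf.
have Lf := BVf.1.
pose F x := clip A (f x).
have bF : bounded_meas F := bounded_meas_clip (ltW A0) (L1_measurable Lf).
have FA x : `|F x| <= A by exact: clip_le (ltW A0).
have fF : ae_eq01 f F.
  apply: (ae_impl (BV_ae_bounded Lf fA)) => x /= + Ix => /(_ Ix) fxA.
  by rewrite /F clip_id.
have fFT k :
    ae_eq01 (fun x => f (seq_map T 1 k x)) (fun x => F (seq_map T 1 k x)).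
  exact: (nonsingular_ae (nsTk k) fF).
have bFT k := bounded_meas_comp (nsTk k) bF.
pose c k := \int[leb]_(x in I) F (seq_map T 1 k x).
have cE k : \int[leb]_(x in I) f (seq_map T 1 k x) = c k.
  apply: ae_Rintegral (fFT k); last exact: (bFT k).1.
  exact: measurable_nonsingular_comp (nsTk k) (L1_measurable Lf).
have cA k : `|c k| <= A by apply: Rintegral_le_bound => // x Ix; exact: FA.
have cg k : \int[leb]_(x in I) (g k x * F x) = c k.
  rewrite seq_transfer_dual//; last exact: L1_cst.
  by apply: eq_Rintegral => x _; rewrite mul1r.
pose phi k x := (f x - c k) * g k x.
(* The bound of [BV_shiftM] with [|c k| <= A], uniform in [k]. *)
pose D0 := (A + A) * B + B * A + (A + A) * B.
have D00 : 0 < D0 by rewrite !addr_gt0 ?mulr_gt0 ?addr_gt0.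
have phiP k : L1 (phi k) /\ (BVnorm (phi k) <= D0%:E)%E.
  have [Lphi phiB] := BV_shiftM (c k) Lf (Lg k) fA (gB k).
  split => //; apply: (le_trans phiB); rewrite lee_fin /D0.
  by rewrite lerD// ?lerD2r ler_wpM2r ?(ltW B0)// lerD2l cA.
have Lphi k : L1 (phi k) by case: (phiP k).
have phiB k : (BVnorm (phi k) <= D0%:E)%E by case: (phiP k).
have LgF k : L1 (fun x => g k x * F x) by exact: L1M.
have Lcg k : L1 (fun x => c k * g k x).
  by have := L1M (Lg k) (bounded_meas_cst (c k)); under eq_fun do rewrite mulrC.
have phi0 k : (\int[leb]_(x in I) (phi k x)%:E = 0)%E.
  rewrite -L1_EFin_Rintegral//; congr EFin.
  transitivity (\int[leb]_(x in I) (g k x * F x - c k * g k x)).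
    apply: ae_Rintegral; first exact: L1_measurable.
      exact: L1_measurable (L1B (LgF k) (Lcg k)).
    by apply: (ae_impl fF) => x /= + Ix => /(_ Ix) fx; rewrite /phi fx; ring.
  rewrite RintegralB; [|exact: mI'|exact: LgF|exact: Lcg].
  by rewrite RintegralZl; [rewrite cg gint mulr1 subrr|exact: mI'|exact: Lg].
have [th0 th1] := andP t01.
(* [D0 + 1] in place of [D0] makes the BV bound strict, as [BV_ae_bounded] requires. *)
pose K1 := K0 * (D0 + 1).
have K10 : 0 < K1 by rewrite mulr_gt0// addr_gt0.
have pushedK i l : (1 <= l)%N ->
    {ae leb, forall x, I x -> `|pushed T phi i l x| <= K1 * theta ^+ l}.
  move=> l1; apply: BV_ae_bounded; first exact: pushed_L1.
  apply: (le_lt_trans (Dec l (fun j => T (i + j)%N) (phi i) l1 _ _ (phi0 i))).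
  - by move=> j /andP[j1 _]; apply: CT; rewrite (leq_trans j1)// leq_addl.
  - exact: BVnorm_BV (Lphi i) (phiB i).
  - apply: (@le_lt_trans _ _ ((K0 * theta ^+ l)%:E * D0%:E)%E).
      by apply: lee_wpmul2l; rewrite ?lee_fin ?phiB// mulr_ge0 ?exprn_ge0// ltW.
    rewrite -EFinM lte_fin /K1 mulrAC ltr_pM2r ?exprn_gt0//.
    by rewrite ltr_pM2l// ltrDl.
pose Hb := K1 / (1 - theta) / delta.
have Hb0 : 0 <= Hb by rewrite !divr_ge0// ltW// subr_gt0.
pose H := corrector T phi.
have LH k : L1 (H k) by exact: corrector_L1.
have HN k := corrector_bound k (ltW K10) t01 pushedK.
(* This is [H_k / g_k]: the maximum and the truncation are both inactive almost everywhere, and make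
   [h k] measurable and bounded everywhere. *)
pose h k x := clip Hb (H k x * Num.max delta (g k x) `^ (-1)).
have bh k : bounded_meas (h k).
  apply: bounded_meas_clip => //.
  apply: measurable_funM; first exact: L1_measurable.
  apply: (measurableT_comp (measurable_powR _)).
  by apply: measurable_maxr => //; exact: L1_measurable.
have hHb k x : `|h k x| <= Hb by exact: clip_le.
have gh k : ae_eq01 (fun x => g k x * h k x) (H k).
  apply: (ae_impl2 (gd k) (HN k)) => x /= dg HNx Ix; rewrite /h.
  have {}dg := dg Ix; have {}HNx := HNx Ix.
  have gx0 : 0 < g k x by rewrite (lt_le_trans d0).
  rewrite max_r// powR_inv1 ?(ltW gx0)// clip_id.
    by rewrite mulrC divfK// gt_eqF.
  rewrite normrM normfV (gtr0_norm gx0) ler_pM ?invr_ge0 ?(ltW gx0)//.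
  by rewrite lef_pV2 ?posrE.
pose U k x := F x - c k + h k x - h k.+1 (T k.+1 x).
pose M := A + A + Hb + Hb.
have M0 : 0 < M by rewrite /M; clearbody Hb; lra.
have bhT k := bounded_meas_comp (nsT k) (bh k.+1).
have bU k : bounded_meas (U k).
  apply: (bounded_measD _ (bounded_measN (bhT k))).
  apply: (bounded_measD _ (bh k)).
  exact: (bounded_measD bF (bounded_meas_cst (- c k))).
have UM k x : I x -> `|U k x| <= M.
  move=> _; rewrite /U /M (le_trans (ler_normB _ _))// lerD//.
  rewrite (le_trans (ler_normD _ _))// lerD//.
  by rewrite (le_trans (ler_normB _ _))// lerD.
have dual k G : bounded_meas G -> \int[leb]_(x in I) (g k.+1 x * G x) =
    \int[leb]_(x in I) (g k x * G (T k.+1 x)).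
  by move=> bG; rewrite /g seq_transferS (transfer_dual (nsT k) (Lg k) bG).
have ort k G : bounded_meas G ->
    \int[leb]_(x in I) (g k x * (U k x * G (T k.+1 x))) = 0.
  move=> bG; have bGT := bounded_meas_comp (nsT k) bG.
  have LpH := L1D (Lphi k) (LH k).
  have LV := L1M LpH bGT.
  have LW := L1M (Lg k) (bounded_measM (bhT k) bGT).
  (* Almost everywhere [g_k h_k = H_k]. By duality the first term becomes the integral of
     [P_(k+1) (phi_k + H_k) G] and the second that of [g_(k+1) h_(k+1) G]; both equal the integral
     of [H_(k+1) G]. *)
  transitivity (\int[leb]_(x in I) ((phi k x + H k x) * G (T k.+1 x) -
      g k x * (h k.+1 (T k.+1 x) * G (T k.+1 x)))).
    apply: ae_Rintegral.
    - exact: L1_measurable (L1M (Lg k) (bounded_measM (bU k) bGT)).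
    - exact: L1_measurable (L1B LV LW).
    - apply: (ae_impl2 fF (gh k)) => x /= fx ghx Ix.
      by rewrite -(ghx Ix) /phi (fx Ix) /U; ring.
  rewrite RintegralB; [|exact: mI'|exact: LV|exact: LW].
  rewrite -transfer_dual// -(dual k (fun x => h k.+1 x * G x)); last first.
    exact: bounded_measM.
  apply/eqP; rewrite subr_eq0; apply/eqP; apply: ae_Rintegral.
  - exact: L1_measurable (L1M (transfer_L1 (nsT k) LpH) bG).
  - exact: L1_measurable (L1M (Lg k.+1) (bounded_measM (bh k.+1) bG)).
  - apply: (ae_impl2 (correctorS nsT Lphi k) (gh k.+1)) => x /= cx ghx Ix.
    by rewrite -(cx Ix) -/(H k.+1 x) -(ghx Ix); ring.
have tele n x : \sum_(k < n) U k (seq_map T 1 k x) =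
    \sum_(k < n) (F (seq_map T 1 k x) - c k) + h 0 x - h n (seq_map T 1 n x).
  elim: n => [|n IH]; first by rewrite !big_ord0 add0r subrr.
  by rewrite !big_ord_recr/= IH /U seq_mapS; ring.
(* The exponent [2 n (lam M)^2 - lam n t] is minimal at [lam = t / (4 M^2)], with value
   [- n t^2 / (8 M^2)]; [M] does not involve [t]. *)
exists (8 * M ^+ 2)^-1; first by rewrite invr_gt0 mulr_gt0// exprn_gt0.
move=> t t0; pose lam := t / (4 * M ^+ 2).
have lam0 : 0 < lam by rewrite divr_gt0// mulr_gt0// exprn_gt0.
(* The coboundary [h_0 - h_n o T_1^n] is at most [2 Hb] in absolute value, which lowers the
   threshold [n t] by that amount. *)
exists (expR (2 * lam * Hb)); first exact: expR_gt0.
move=> n n1; have n0 : 0 < n%:R :> R by rewrite ltr0n.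
pose a := expR (lam * (n%:R * t - 2 * Hb)).
pose b := expR (2 * (lam * M) ^+ 2) ^+ n.
have -> : expR (2 * lam * Hb) *
    expR (- ((8 * M ^+ 2)^-1 * n%:R * t ^+ 2)) = b / a.
  rewrite /b /a -expRM_natr -expRN -!expRD /lam; congr expR.
  by field; rewrite gt_eqF.
apply: (@markov_unitI _ (exp_sum lam T U n 0)).
- exact: bounded_meas_exp_sum (fun k => (bU k).1) UM _ _.
- by move=> x _; exact: exp_sum_ge0.
- exact: expR_gt0.
(* At [j = 0] the weight is [g 0 = 1], so the estimate is for Lebesgue measure itself. *)
- have := azuma lam nsT Lg g0 (fun k => (bU k).1) UM dual ort n 0.
  rewrite gint mulr1; apply: le_trans.
  by under [leRHS]eq_Rintegral do rewrite mul1r.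
- have : {ae leb, forall x, forall k, I x ->
      f (seq_map T 1 k x) = F (seq_map T 1 k x)}.
    by apply: ae_foralln => k; exact: fFT.
  move/ae_impl; apply => x /= fFx [Ix]; rewrite big_mkord => tS; split => //.
  rewrite -[x]/(seq_map T 1 0 x) exp_sumE tele ler_expR ler_pM2l//.
  have SE : \sum_(k < n) (f (seq_map T 1 k x) -
      \int[lebesgue_measure]_(y in @unitI R) f (seq_map T 1 k y)) =
      \sum_(k < n) (F (seq_map T 1 k x) - c k).
    by apply: eq_bigr => k _; rewrite fFx// cE.
  move: tS; rewrite SE -(ltr_pM2l n0) mulrA divff ?gt_eqF// mul1r => tS.
  have := hHb 0 x; have := hHb n (seq_map T 1 n x).
  rewrite !ler_norml => /andP[_ h1] /andP[h2 _].
  by move: tS h1 h2; clearbody Hb; lra.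
Qed.
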